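(* $\mathrm{ex}(n,\{\text{ears},\text{bat},\text{mariposa}\})\in\Omega(n^3)$ as $n\to\infty$.
   Context: Let $P$ be a set of $n$ points in convex position in the plane (the vertices of a convex $n$-gon); a triangle on $P$ is a 3-element subset of $P$. For two distinct triangles $t_1,t_2$ on $P$, label each point of $t_1\cup t_2$ by the triangle(s) containing it and read the points in their cyclic order around the polygon. The pair forms exactly one of eight configurations. (i) If $t_1,t_2$ share two vertices $u,v$: ''taco'' if their third vertices lie on the same side of the line $uv$, ''mariposa'' if on opposite sides. (ii) If they share exactly one vertex $v$: read the remaining four vertices in cyclic order starting just after $v$; ''bat'' if the pattern is $t_1t_1t_2t_2$ or $t_2t_2t_1t_1$, ''nested'' if it is $t_1t_2t_2t_1$ or $t_2t_1t_1t_2$, ''crossing'' if it is $t_1t_2t_1t_2$ or $t_2t_1t_2t_1$. (iii) If they share no vertex, the cyclic sequence of the six labels is, up to rotation, reflection and exchanging the roles of $t_1,t_2$, one of: ''ears'' $AAABBB$, ''swords'' $AABABB$, ''david'' $ABABAB$. For a set $X$ of configurations, $\mathrm{ex}(n,X)$ is the maximum size of a family of triangles on $P$ in which no two triangles form a configuration belonging to $X$ (this depends only on $n$ and $X$). *)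

(* Defs.v *)
From HB Require Import structures.
From mathcomp Require Import all_boot all_order all_algebra.
From mathcomp Require Import reals ring.

Set Implicit Arguments.
Unset Strict Implicit.
Unset Printing Implicit Defensive.
Import Order.TTheory GRing.Theory Num.Theory.
Local Open Scope ring_scope.

Inductive config :=
  Taco | Mariposa | Bat | Nested | Crossing | Ears | Swords | David.

Definition config_code (c : config) : 'I_8 :=
  match c with
  | Taco => inord 0 | Mariposa => inord 1 | Bat => inord 2 | Nested => inord 3
  | Crossing => inord 4 | Ears => inord 5 | Swords => inord 6 | David => inord 7
  end.

Definition config_decode (i : 'I_8) : config :=
  nth Taco [:: Taco; Mariposa; Bat; Nested; Crossing; Ears; Swords; David] i.

Lemma config_codeK : cancel config_code config_decode.
Proof. by case; rewrite /config_decode /= inordK. Qed.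

HB.instance Definition _ := Finite.copy config (can_type config_codeK).

(* The n points are p 0, ..., p (n - 1), in no particular order: the labelling
   is not assumed to follow the polygon. No point is a convex combination of
   the other ones; in particular p is injective. *)
Definition convex_position (R : realType) (n : nat) (p : 'I_n -> 'rV[R]_2) :=
  forall i : 'I_n, ~ exists w : 'I_n -> R,
    [/\ forall j, 0 <= w j, w i = 0, \sum_j w j = 1
      & \sum_j w j *: p j = p i].

(* Twice the signed area of the triangle abc. Its sign tells on which side of
   the line ab the point c lies; it is positive when a, b, c is a
   counterclockwise turn. *)
Definition orient (R : realType) (a b c : 'rV[R]_2) : R :=
  (b 0 0 - a 0 0) * (c 0 1 - a 0 1) - (b 0 1 - a 0 1) * (c 0 0 - a 0 0).

(* The points of s appear in this (counterclockwise) cyclic order around the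
   polygon, starting from the first one. All the configurations below are
   invariant under reflection, so the choice of a direction is immaterial. *)
Definition cyclically_ordered (R : realType) (n : nat) (p : 'I_n -> 'rV[R]_2)
    (k : nat) (s : k.-tuple 'I_n) : bool :=
  [forall i : 'I_k, forall j : 'I_k, forall l : 'I_k, (i < j < l)%N ==>
     (0 < orient (p (tnth s i)) (p (tnth s j)) (p (tnth s l)))].

(* s lists each point of A once, in cyclic order. *)
Definition reading (R : realType) (n : nat) (p : 'I_n -> 'rV[R]_2)
    (A : {set 'I_n}) (k : nat) (s : k.-tuple 'I_n) : bool :=
  [&& uniq s, [set x in s] == A & cyclically_ordered p s].

(* t1 and t2 share exactly two vertices u and v, and side holds of the
   orientations of uvw1 and uvw2, with w1, w2 the third vertices. *)
Definition share2 (R : realType) (n : nat) (p : 'I_n -> 'rV[R]_2)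
    (side : R -> R -> bool) (t1 t2 : {set 'I_n}) : bool :=
  [exists u, exists v, exists w1, exists w2,
    [&& u != v, t1 :&: t2 == [set u; v],
        t1 :\: t2 == [set w1], t2 :\: t1 == [set w2]
      & side (orient (p u) (p v) (p w1)) (orient (p u) (p v) (p w2))]].

(* t1 and t2 share exactly one vertex v, and the labels of the four other ones,
   read in cyclic order from just after v, form one of the given patterns. In a
   pattern, true stands for t1 and false for t2. *)
Definition share1 (R : realType) (n : nat) (p : 'I_n -> 'rV[R]_2)
    (pats : seq bitseq) (t1 t2 : {set 'I_n}) : bool :=
  [exists v, exists s : 4.-tuple 'I_n,
    [&& t1 :&: t2 == [set v], reading p (t1 :|: t2) [tuple of v :: s]
      & [seq x \in t1 | x <- s] \in pats]].

(* Equality of cyclic label sequences up to rotation, reflection and exchange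
   of the two labels. *)
Definition cyclic_equiv (l m : bitseq) : bool :=
  has (fun k => [|| l == rot k m, l == rot k (rev m),
                    l == rot k (map negb m) | l == rot k (rev (map negb m))])
      (iota 0%N (size m)).

Definition share0 (R : realType) (n : nat) (p : 'I_n -> 'rV[R]_2)
    (pat : bitseq) (t1 t2 : {set 'I_n}) : bool :=
  [exists s : 6.-tuple 'I_n,
    [&& t1 :&: t2 == set0, reading p (t1 :|: t2) s
      & cyclic_equiv [seq x \in t1 | x <- s] pat]].

Definition forms (R : realType) (n : nat) (p : 'I_n -> 'rV[R]_2)
    (c : config) (t1 t2 : {set 'I_n}) : bool :=
  let A := true in let B := false in
  match c with
  | Taco => share2 p (fun x y => 0 < x * y) t1 t2
  | Mariposa => share2 p (fun x y => x * y < 0) t1 t2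
  | Bat => share1 p [:: [:: A; A; B; B]; [:: B; B; A; A]] t1 t2
  | Nested => share1 p [:: [:: A; B; B; A]; [:: B; A; A; B]] t1 t2
  | Crossing => share1 p [:: [:: A; B; A; B]; [:: B; A; B; A]] t1 t2
  | Ears => share0 p [:: A; A; A; B; B; B] t1 t2
  | Swords => share0 p [:: A; A; B; A; B; B] t1 t2
  | David => share0 p [:: A; B; A; B; A; B] t1 t2
  end.

Definition avoids (R : realType) (n : nat) (p : 'I_n -> 'rV[R]_2)
    (X : {set config}) (F : {set {set 'I_n}}) : bool :=
  [forall t in F, #|t| == 3%N] &&
  [forall t1 in F, forall t2 in F, (t1 != t2) ==>
     [forall c in X, ~~ forms p c t1 t2]].

Definition ex_triangles (R : realType) (n : nat) (p : 'I_n -> 'rV[R]_2)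
    (X : {set config}) : nat :=
  \max_(F : {set {set 'I_n}} | avoids p X F) #|F|.

(* Convex position is attained for every n: points of a parabola. *)
Lemma convex_position_parabola (R : realType) (n : nat) :
  convex_position (fun i : 'I_n => \row_(k < 2) (i%:R ^+ k.+1 : R)).
Proof.
move=> i [w [w0 wi w1 wp]].
have e (k : 'I_2) : \sum_j w j * j%:R ^+ k.+1 = i%:R ^+ k.+1.
  move/rowP/(_ k): wp; rewrite summxE mxE => <-.
  by apply: eq_bigr => j _; rewrite !mxE.
have /eqP : \sum_j w j * (j%:R - i%:R) ^+ 2 = 0.
  transitivity (\sum_j w j * j%:R ^+ 2 - (\sum_j w j * j%:R ^+ 1) * (2 * i%:R)
                + (\sum_j w j) * i%:R ^+ 2); last first.
    by rewrite w1 (e 0) (e 1) /=; ring.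
  rewrite !mulr_suml -sumrB -big_split /=.
  by apply: eq_bigr => j _; ring.
rewrite psumr_eq0 => [/allP h|j _]; last by rewrite mulr_ge0 // sqr_ge0.
move: w1; rewrite big1 => [/eqP|j _]; first by rewrite eq_sym oner_eq0.
have := h j (mem_index_enum _); rewrite /=.
rewrite mulf_eq0 => /orP[/eqP //|]; rewrite sqrf_eq0 subr_eq0 eqr_nat.
by move=> /eqP/val_inj ->.
Qed.

(* Main.v *)
Require Import Defs.
From mathcomp Require Import all_boot all_order all_algebra.
From mathcomp Require Import reals.
From mathcomp Require Import zify ring lra.
Import Order.TTheory GRing.Theory Num.Theory.
Local Open Scope ring_scope.

(** Split the polygon into three consecutive arcs of about n/3 points and take
    all triangles with one vertex in each arc. Two triangles forming ears, a bat
    or a mariposa are separated by an edge uw of one of them: its third vertex v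
    and the other triangle lie on opposite sides of the line uw. This is
    impossible in the family, since the other triangle has a vertex in the arc
    of v, which lies on the same side of uw as v. *)

Lemma forall_ord2 (P : 'I_2 -> Prop) : P 0 -> P 1 -> forall k, P k.
Proof.
move=> P0 P1 [[|[|//]] kP].
- by rewrite (_ : Ordinal kP = 0) //; apply/val_inj.
- by rewrite (_ : Ordinal kP = 1) //; apply/val_inj.
Qed.

(** * Signs of orientations in convex position *)

Section ConvexPosition.
Context (R : realType) (n : nat) (p : 'I_n -> 'rV[R]_2).

Local Notation ori i j k := (orient (p i) (p j) (p k)).

Lemma orient_rot (a b c : 'rV[R]_2) : orient a b c = orient b c a.
Proof. by rewrite /orient; ring. Qed.

Lemma orient_swap (a b c : 'rV[R]_2) : orient a b c = - orient a c b.
Proof. by rewrite /orient; ring. Qed.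

Lemma orient_xxy (a b : 'rV[R]_2) : orient a a b = 0.
Proof. by rewrite /orient; ring. Qed.

Hypothesis p_convex : convex_position p.

(** Unnormalised weights let squared lengths and areas serve directly as coefficients; dividing by
    their sum gives the combination that convex position forbids. The points [a], [b], [c] may
    coincide, since their indicator weights add up. *)
Lemma convex_position_not_barycenter (i a b c : 'I_n) (x y z : R) :
    a != i -> b != i -> c != i ->
    0 <= x -> 0 <= y -> 0 <= z -> 0 < x + y + z ->
    (forall k, x * p a 0 k + y * p b 0 k + z * p c 0 k
               = (x + y + z) * p i 0 k) ->
  False.
Proof.
move=> ai bi ci x0 y0 z0 s0 e; apply: (p_convex i).
pose d (q j : 'I_n) : R := (j == q)%:R.
exists (fun j => (x * d a j + y * d b j + z * d c j) / (x + y + z)).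
have d0 q j : 0 <= d q j by rewrite /d ler0n.
have sum_d (V : lmodType R) (q : 'I_n) (f : 'I_n -> V) : \sum_j d q j *: f j = f q.
  rewrite (bigD1 q) //= /d eqxx scale1r big1 ?addr0 // => j /negbTE ->.
  by rewrite scale0r.
have sum_w (V : lmodType R) (f : 'I_n -> V) :
    \sum_j ((x * d a j + y * d b j + z * d c j) / (x + y + z)) *: f j
    = (x + y + z)^-1 *: (x *: f a + y *: f b + z *: f c).
  rewrite -(sum_d V a) -(sum_d V b) -(sum_d V c) !scaler_sumr -!big_split /=.
  rewrite scaler_sumr; apply: eq_bigr => j _.
  by rewrite mulrC -scalerA !scalerDl !scalerA.
split.
- by move=> j; rewrite divr_ge0 ?(ltW s0) // !addr_ge0 // mulr_ge0.
- by rewrite /d ![i == _]eq_sym (negbTE ai) (negbTE bi) (negbTE ci) !mulr0 !addr0 mul0r.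
(* The constant function 1, with [R] seen as a module over itself, turns [sum_w] into the total
   weight. *)
- have := sum_w R^o (fun=> 1); rewrite /GRing.scale /= => h.
  under eq_bigr do rewrite -[_ / _]mulr1.
  by rewrite h !mulr1 mulVf // gt_eqF.
- rewrite sum_w; apply/rowP => k; rewrite !mxE e mulKf //; exact: lt0r_neq0.
Qed.

(** Injectivity takes the form of a positive squared distance because [collinear_dot_gt0] uses that
    number as a weight. *)
Lemma convex_position_inj (i j : 'I_n) :
  i != j -> 0 < (p j 0 0 - p i 0 0) ^+ 2 + (p j 0 1 - p i 0 1) ^+ 2.
Proof.
move=> ij; rewrite lt0r addr_ge0 ?sqr_ge0 // andbT; apply/negP.
rewrite paddr_eq0 ?sqr_ge0 // !sqrf_eq0 !subr_eq0 => /andP[/eqP e0 /eqP e1].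
have ji : j != i by rewrite eq_sym.
apply: (convex_position_not_barycenter i j j j 1 0 0 ji ji ji);
  rewrite ?ler01 ?lexx //; first lra.
by apply: forall_ord2; rewrite ?e0 ?e1; ring.
Qed.

(** With a nonpositive dot product, [p i] would lie on the segment from [p j] to [p k]. *)
Lemma collinear_dot_gt0 (i j k : 'I_n) :
    i != j -> i != k -> ori i j k = 0 ->
  0 < (p j 0 0 - p i 0 0) * (p k 0 0 - p i 0 0)
      + (p j 0 1 - p i 0 1) * (p k 0 1 - p i 0 1).
Proof.
move=> ij ik o; rewrite ltNge; apply/negP => D.
have /convex_position_inj v0 := ik.
have [ji ki] : j != i /\ k != i by rewrite ![_ == i]eq_sym.
(* For v = pk - pi and d the dot product, collinearity gives |v|^2 (pj - pi) = d v, whence the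
   weights |v|^2 at [j] and -d at [k]. *)
apply: (convex_position_not_barycenter i j k k _ (- _) 0 ji ki ki (ltW v0)).
- rewrite oppr_ge0; exact: D.
- exact: lexx.
- lra.
- apply: forall_ord2; apply/eqP; rewrite -subr_eq0; apply/eqP.
  + transitivity ((p k 0 1 - p i 0 1) * ori i j k); last by rewrite o mulr0.
    by rewrite /orient; ring.
  + transitivity ((p i 0 0 - p k 0 0) * ori i j k); last by rewrite o mulr0.
    by rewrite /orient; ring.
Qed.

(** If the points were collinear, the dot products at all three vertices would be positive, so that
    none of the points would lie between the other two. *)
Lemma orient_neq0 (i j k : 'I_n) :
  i != j -> j != k -> i != k -> ori i j k != 0.
Proof.
move=> ij jk ik; apply/eqP => o.
have [ji [kj ki]] : j != i /\ k != j /\ k != i by rewrite eq_sym ij eq_sym jk eq_sym.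
have di := collinear_dot_gt0 _ _ _ ij ik o.
have dj : ori j k i = 0 by rewrite -orient_rot.
have dk : ori k i j = 0 by rewrite orient_rot.
have {}dj := collinear_dot_gt0 _ _ _ jk ji dj.
have {}dk := collinear_dot_gt0 _ _ _ ki kj dk.
move: o di dj dk; rewrite /orient.
set a := p j 0 0 - p i 0 0; set b := p k 0 1 - p i 0 1.
set c := p j 0 1 - p i 0 1; set d := p k 0 0 - p i 0 0 => o di dj dk.
have {}dj : a * d + c * b < a ^+ 2 + c ^+ 2 by move: dj; rewrite /a /b /c /d; lra.
have {}dk : a * d + c * b < d ^+ 2 + b ^+ 2 by move: dk; rewrite /a /b /c /d; lra.
(* For u = (a, c) and v = (d, b) this product reads (u.v)^2 < |u|^2 |v|^2, whereas Lagrange's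
   identity gives equality because [a * b - c * d] vanishes. *)
have := ltr_pM (ltW di) (ltW di) dj dk.
have -> : (a ^+ 2 + c ^+ 2) * (d ^+ 2 + b ^+ 2)
    = (a * d + c * b) * (a * d + c * b) + (a * b - c * d) ^+ 2 by ring.
by rewrite o expr0n addr0 ltxx.
Qed.

(* The points other than o, seen from o, span an angle less than pi. *)
Lemma orient_apex_trans (o a b c : 'I_n) : a != o -> b != o -> c != o ->
  0 <= ori o a b -> 0 <= ori o b c -> 0 <= ori o a c.
Proof.
move=> ao bo co ab bc; rewrite leNgt; apply/negP => ac.
(* The weights come from Cramer's rule, the linear relation between the three vectors from [o] to
   [a], [b] and [c]. *)
apply: (convex_position_not_barycenter o a b c _ (- ori o a c) _ ao bo co bc _ ab).
- lra.
- lra.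
- rewrite /orient; apply: forall_ord2; ring.
Qed.

(** If [ori a b c] were negative, [b] would lie in the triangle [o a c], with the areas of the three
    subtriangles at [b] as barycentric coordinates. *)
Lemma orient_apex_gt0 (o a b c : 'I_n) :
    uniq [:: o; a; b; c] ->
  0 <= ori o a b -> 0 <= ori o b c -> 0 <= ori o a c -> 0 < ori a b c.
Proof.
rewrite /= !inE !negb_or andbT.
move=> /and3P[/and3P[oa ob oc] /andP[ab ac] bc] h1 h2 h3.
have h4 := orient_neq0 _ _ _ ab bc ac.
have h5 := orient_neq0 _ _ _ oa ac oc.
rewrite lt0r h4 leNgt; apply/negP => h.
have cb : c != b by rewrite eq_sym.
apply: (convex_position_not_barycenter b o a c (- ori a b c) _ _ ob ab cb _ h2 h1).
- lra.
- move: (h3) h5; rewrite le0r => /orP[/eqP -> /eqP //|]; rewrite /orient; lra.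
- rewrite /orient; apply: forall_ord2; ring.
Qed.

(** The points other than a fixed [o] are sorted by angle around [o], and three consecutive blocks
    of length [m] are cut off. The strict bound leaves room for [o]. *)
Lemma three_arcs (m : nat) : (3 * m < n)%N ->
  exists A B C : {set 'I_n},
    [/\ #|A| = m, #|B| = m, #|C| = m
      & forall a b c, a \in A -> b \in B -> c \in C -> 0 < ori a b c].
Proof.
move=> mn; have n0 : (0 < n)%N by lia.
pose o : 'I_n := Ordinal n0; pose r : rel 'I_n := fun j k => 0 <= ori o j k.
pose s := sort r (enum (predC1 o)).
have s_o : all (predC1 o) s by apply/allP => x; rewrite mem_sort mem_enum.
have s_uniq : uniq s by rewrite sort_uniq enum_uniq.
have s_size : size s = n.-1.
  by rewrite size_sort -cardE cardC1 card_ord.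
have s_sorted : pairwise r s.
  (* Transitivity of [r] is available only away from [o], hence the version relative to
     [predC1 o]. *)
  rewrite -(@sorted_pairwise_in _ (predC1 o)) //; last first.
    by move=> b a c /= bo ao co; apply: orient_apex_trans.
  by apply: sort_sorted => j k; rewrite /r (orient_swap _ (p k)) oppr_ge0 le_total.
clearbody s; move: s_o s_uniq s_size s_sorted.
rewrite -(cat_take_drop m s); set s1 := take m s; set s' := drop m s.
rewrite -(cat_take_drop m s'); set s2 := take m s'; set s'' := drop m s'.
rewrite -(cat_take_drop m s''); set s3 := take m s''; set s4 := drop m s''.
move=> s_o s_uniq s_size s_sorted.
have s_size' : size s = n.-1 by rewrite -s_size !cat_take_drop.
have z1 : size s1 = m by rewrite size_take_min; lia.
have z2 : size s2 = m by rewrite size_take_min size_drop; lia.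
have z3 : size s3 = m by rewrite size_take_min !size_drop; lia.
clearbody s1 s2 s3 s4; clear s' s''.
move: (s_uniq); rewrite !cat_uniq => /and5P[u1 _ u2 _ /and3P[u3 _ _]].
exists [set x in s1], [set x in s2], [set x in s3].
split.
- by rewrite cardsE (card_uniqP u1).
- by rewrite cardsE (card_uniqP u2).
- by rewrite cardsE (card_uniqP u3).
move=> a b c; rewrite !inE => a1 b2 c3.
move: s_sorted; rewrite !pairwise_cat !allrel_catr.
case/and3P => /and3P[/allrelP r12 /allrelP r13 _] _ /and3P[/andP[/allrelP r23 _] _ _].
apply: (@orient_apex_gt0 o).
- have abc_uniq : uniq [:: a; b; c].
    apply: (@subseq_uniq _ _ (s1 ++ s2 ++ s3 ++ s4)) => //.
    rewrite -[[:: a; b; c]]/([:: a] ++ [:: b] ++ [:: c] ++ [::]).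
    by rewrite !cat_subseq ?sub1seq ?sub0seq.
  move: s_o; rewrite !all_cat => /and4P[/allP/(_ a a1) ao /allP/(_ b b2) bo].
  move=> /allP/(_ c c3) co _; rewrite cons_uniq abc_uniq !inE !negb_or.
  by rewrite ![o == _]eq_sym andbT; apply/and3P.
- exact: r12.
- exact: r23.
- exact: r13.
Qed.

End ConvexPosition.

(** * Separating edges in ears, bats and mariposas *)

Section Separation.
Context (R : realType) (n : nat) (p : 'I_n -> 'rV[R]_2).

Local Notation ori i j k := (orient (p i) (p j) (p k)).

(** The separating edge is [u w]: since [ori u w v] is negative, [v] lies strictly on the other
    side. The triangle [t2] may touch the ends of the edge, as happens in bats and mariposas. *)
Definition separated (t1 t2 : {set 'I_n}) : Prop :=
  exists u v w, [/\ u \in t1, v \in t1, w \in t1, 0 < ori u v w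
    & forall y, y \in t2 -> [|| y == u, y == w | 0 < ori u w y]].

Lemma cyclically_ordered_nth (k : nat) (s : k.-tuple 'I_n) x i j l :
    cyclically_ordered p s -> (i < j)%N -> (j < l)%N -> (l < k)%N ->
  0 < ori (nth x s i) (nth x s j) (nth x s l).
Proof.
move=> so ij jl lk; have jk := ltn_trans jl lk; have ik := ltn_trans ij jk.
move/forallP/(_ (Ordinal ik))/forallP/(_ (Ordinal jk)): so.
by move=> /forallP/(_ (Ordinal lk)); rewrite !(tnth_nth x) /= ij jl.
Qed.

(** The chord between positions [i] and [l] has the positions strictly between them on one side and
    all the others on the opposite side. *)
Lemma cyclically_ordered_separated (k : nat) (s : k.-tuple 'I_n) x i j l
    (t1 t2 : {set 'I_n}) :
    cyclically_ordered p s -> (i < j)%N -> (j < l)%N -> (l < k)%N ->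
    nth x s i \in t1 -> nth x s j \in t1 -> nth x s l \in t1 ->
    {subset t2 <= s} ->
    (forall q, (i < q)%N -> (q < l)%N -> nth x s q \notin t2) ->
  separated t1 t2.
Proof.
move=> so ij jl lk it jt lt t2s t2il.
exists (nth x s i), (nth x s j), (nth x s l); split=> //.
  exact: cyclically_ordered_nth.
move=> y yt2; have /(nthP x)[q] := t2s y yt2; rewrite size_tuple => qk yq.
rewrite -{}yq in yt2 *.
have [qi|iq|->] := ltngtP q i; last by rewrite eqxx.
  by rewrite -orient_rot cyclically_ordered_nth ?orbT // (ltn_trans ij jl).
have [ql|lq|->] := ltngtP q l; last by rewrite eqxx orbT.
  by have := t2il q iq ql; rewrite yt2.
by rewrite cyclically_ordered_nth ?orbT // (ltn_trans ij jl).
Qed.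

(** Wherever the cyclic word AAABBB is cut open, at least one of its two blocks stays whole; the
    chord joining the ends of that block separates. *)
Lemma ears_separated (t1 t2 : {set 'I_n}) :
  forms p Ears t1 t2 -> separated t1 t2 \/ separated t2 t1.
Proof.
case/existsP => s /and3P[/eqP tI /and3P[_ /eqP sE so] pat].
have t12 y : y \in t1 -> y \notin t2.
  by move=> y1; apply/negP => y2; have := in_set0 y; rewrite -tI inE y1 y2.
have s1 : {subset t1 <= s}.
  by move=> y y1; have := in_setU y t1 t2; rewrite -sE inE y1.
have s2 : {subset t2 <= s}.
  by move=> y y2; have := in_setU y t1 t2; rewrite -sE inE y2 orbT.
have sU y : y \in s -> y \notin t1 -> y \in t2.
  by have := in_setU y t1 t2; rewrite -sE inE; case: (y \in t1) => //= ->.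
have x := tnth s ord0.
have sep1 i : (i.+2 < 6)%N -> [/\ nth x s i \in t1, nth x s i.+1 \in t1
    & nth x s i.+2 \in t1] -> separated t1 t2.
  move=> i6 [h0 h1 h2]; apply: (@cyclically_ordered_separated _ s x i i.+1 i.+2) => //.
  move=> q iq qi; have -> : q = i.+1 by lia.
  exact: t12.
have sep2 i : (i.+2 < 6)%N -> [/\ nth x s i \notin t1, nth x s i.+1 \notin t1
    & nth x s i.+2 \notin t1] -> separated t2 t1.
  move=> i6 [h0 h1 h2].
  apply: (@cyclically_ordered_separated _ s x i i.+1 i.+2) => //;
    try by apply: sU => //; rewrite mem_nth // size_tuple; lia.
  by move=> q iq qi; have -> : q = i.+1 by lia.
move: sep1 sep2 pat; clear; case: s => [[|x0 [|x1 [|x2 [|x3 [|x4 [|x5 [|//]]]]]]] //= _].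
rewrite /cyclic_equiv /=.
(* A run of three among six positions starts at 0, 1, 2 or 3. These instances are then tried on each
   of the 64 labellings. *)
move=> /[dup] /(_ 0%N) /= a0 /[dup] /(_ 1%N) /= a1 /[dup] /(_ 2%N) /= a2 /(_ 3%N) /= a3.
move=> /[dup] /(_ 0%N) /= b0 /[dup] /(_ 1%N) /= b1 /[dup] /(_ 2%N) /= b2 /(_ 3%N) /= b3.
move: a0 a1 a2 a3 b0 b1 b2 b3.
case: (x0 \in t1); case: (x1 \in t1); case: (x2 \in t1);
case: (x3 \in t1); case: (x4 \in t1); case: (x5 \in t1) => // a0 a1 a2 a3 b0 b1 b2 b3 _;
  by [left; apply: a0 | left; apply: a1 | left; apply: a2 | left; apply: a3
     |right; apply: b0 |right; apply: b1 |right; apply: b2 |right; apply: b3].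
Qed.

(** In the reading that starts at the shared vertex, one triangle occupies positions 0, 1, 2, and
    its edge from 0 to 2 separates. *)
Lemma bat_separated (t1 t2 : {set 'I_n}) :
  forms p Bat t1 t2 -> separated t1 t2 \/ separated t2 t1.
Proof.
case/existsP => v /existsP[s /and3P[/eqP tI /and3P[su /eqP sE so] pat]].
have [v1 v2] : v \in t1 /\ v \in t2.
  by apply/andP; rewrite -in_setI tI set11.
have s1 : {subset t1 <= [tuple of v :: s]}.
  by move=> y y1; have := in_setU y t1 t2; rewrite -sE inE y1.
have s2 : {subset t2 <= [tuple of v :: s]}.
  by move=> y y2; have := in_setU y t1 t2; rewrite -sE inE y2 orbT.
have sU y : y \in s -> (y \in t2) = (y \notin t1).
  move=> ys; have := in_setU y t1 t2; rewrite -sE !inE ys orbT.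
  have := in_setI y t1 t2; rewrite tI inE.
  have -> : (y == v) = false by apply/negP => /eqP yv; move: su; rewrite /= -yv ys.
  by case: (y \in t1) => //= <-.
move: so s1 s2 sU pat; clear su sE.
case: s => [[|x1 [|x2 [|x3 [|x4 [|//]]]]] //= sP] so s1 s2 sU.
have e1 := sU x1; have e2 := sU x2; have e3 := sU x3; have e4 := sU x4.
rewrite !inE !eqxx ?orbT /= in e1 e2 e3 e4.
rewrite !inE !eqseq_cons !eqb_id !eqbF_neg !andbT => /orP[] /and4P[h1 h2 h3 h4].
- left; apply: (cyclically_ordered_separated _ _ v 0 1 2 _ _ so) => //=.
  by case=> [|[|]] //= _ _; rewrite e1 ?h1.
- right; apply: (cyclically_ordered_separated _ _ v 0 1 2 _ _ so) => //=.
  + by rewrite e1 ?h1.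
  + by rewrite e2 ?h2.
  + by case=> [|[|]].
Qed.

(** The shared edge itself separates. *)
Lemma mariposa_separated (t1 t2 : {set 'I_n}) :
  forms p Mariposa t1 t2 -> separated t1 t2.
Proof.
case/existsP=> u /existsP[v /existsP[w1 /existsP[w2]]].
case/and5P=> uv /eqP tI /eqP t1D /eqP t2D side.
have : u \in t1 :&: t2 by rewrite tI !inE eqxx.
have : v \in t1 :&: t2 by rewrite tI !inE eqxx orbT.
rewrite !inE => /andP[v1 v2] /andP[u1 u2].
have : w1 \in t1 :\: t2 by rewrite t1D !inE.
have : w2 \in t2 :\: t1 by rewrite t2D !inE.
rewrite !inE => /andP[_ w22] /andP[_ w11].
have e2 y : y \in t2 -> [|| y == u, y == v | y == w2].
  move=> y2; case y1 : (y \in t1).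
    by have := in_setI y t1 t2; rewrite tI y1 y2 !inE orbA => ->.
  by have := in_setD t2 t1 y; rewrite t2D y1 y2 !inE => ->; rewrite !orbT.
(* The side of [w1] decides in which direction the shared edge is traversed; [side] rules out the
   degenerate case. *)
have [h|h|h] := ltgtP 0 (ori u v w1).
- have h2 : ori u v w2 < 0 by move: side; rewrite pmulr_rlt0.
  exists v, w1, u; split=> //; first by rewrite -orient_rot.
  move=> y /e2 /or3P[] /eqP ->; rewrite ?eqxx ?orbT //.
  by rewrite orient_rot orient_swap oppr_gt0 h2 !orbT.
- have h2 : 0 < ori u v w2 by move: side; rewrite nmulr_rlt0.
  exists u, w1, v; split=> //; first by rewrite orient_swap oppr_gt0.
  by move=> y /e2 /or3P[] /eqP ->; rewrite ?eqxx ?h2 ?orbT.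
- by move: side; rewrite -h mul0r ltxx.
Qed.

(** * Triangles with one vertex in each of three arcs *)

Section Transversals.
Context (A B C : {set 'I_n}).
Hypothesis ABC_gt0 : forall a b c, a \in A -> b \in B -> c \in C -> 0 < ori a b c.

Definition transversals : {set {set 'I_n}} :=
  [set [set x.1.1; x.1.2; x.2] | x in setX (setX A B) C].

Lemma transversalsP t : reflect
  (exists a b c, [/\ a \in A, b \in B, c \in C & t = [set a; b; c]])
  (t \in transversals).
Proof.
apply: (iffP imsetP) => [[[[a b] c]]|[a [b [c [aA bB cC ->]]]]].
  by rewrite !inE /= => /andP[/andP[aA bB] cC] ->; exists a, b, c.
by exists (a, b, c); rewrite // !inE /= aA bB.
Qed.

Lemma orient_gt0_neq i j k : 0 < ori i j k -> [/\ i != j, j != k & i != k].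
Proof.
move=> h; split; apply: contraTneq h => ->.
- by rewrite orient_xxy ltxx.
- by rewrite orient_rot orient_xxy ltxx.
- by rewrite -orient_rot orient_xxy ltxx.
Qed.

Lemma transversals_not_separated t1 t2 :
  t1 \in transversals -> t2 \in transversals -> ~ separated t1 t2.
Proof.
case/transversalsP=> [a [b [c [aA bB cC ->]]]].
case/transversalsP=> [a' [b' [c' [a'A b'B c'C ->]]]].
move=> [u [v [w [ut vt wt uvw sep]]]].
(* [y] will be the vertex of the second triangle in the arc of [v]. *)
suff [y yt uyw] : exists2 y, y \in [set a'; b'; c'] & 0 < ori u y w.
  have [uy yw _] := orient_gt0_neq _ _ _ uyw.
  have := sep y yt; rewrite eq_sym (negbTE uy) (negbTE yw) /= orient_swap.
  by rewrite oppr_gt0 ltNge (ltW uyw).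
have abc := ABC_gt0 _ _ _ aA bB cC.
have [uv vw uw] := orient_gt0_neq _ _ _ uvw.
move: ut vt wt uvw uv vw uw; rewrite !inE -!orbA.
(* Distinctness leaves the six permutations of [a], [b], [c]: the even ones provide [y], the odd
   ones contradict the sign of [ori u v w]. *)
move=> /or3P[] /eqP-> /or3P[] /eqP-> /or3P[] /eqP->; rewrite ?eqxx // => h _ _ _.
- by exists b'; rewrite ?inE ?eqxx ?orbT //; apply: ABC_gt0.
- by move: h; rewrite orient_swap oppr_gt0 ltNge ltW.
- by move: h; rewrite orient_rot orient_swap oppr_gt0 ltNge ltW.
- by exists c'; rewrite ?inE ?eqxx ?orbT // -orient_rot; apply: ABC_gt0.
- by exists a'; rewrite ?inE ?eqxx ?orbT // orient_rot; apply: ABC_gt0.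
- by move: h; rewrite -orient_rot orient_swap oppr_gt0 ltNge ltW.
Qed.

Lemma card_transversal t : t \in transversals -> #|t| = 3%N.
Proof.
case/transversalsP=> [a [b [c [aA bB cC ->]]]].
have [ab bc ac] := orient_gt0_neq _ _ _ (ABC_gt0 _ _ _ aA bB cC).
rewrite setUC cardsU1 cards2 ab !inE negb_or.
by rewrite ![c == _]eq_sym ac bc.
Qed.

(** The positive orientation of mixed triples makes points of different arcs distinct, so a triangle
    determines its vertex in each arc. *)
Lemma card_transversals : #|transversals| = (#|A| * #|B| * #|C|)%N.
Proof.
rewrite -!cardsX; apply: card_in_imset => -[[a b] c] [[a' b'] c'].
rewrite !inE /= => /andP[/andP[aA bB] cC] /andP[/andP[a'A b'B] c'C] e.
have [_ _ nac] := orient_gt0_neq _ _ _ (ABC_gt0 a b c' aA bB c'C).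
have [nab _ _] := orient_gt0_neq _ _ _ (ABC_gt0 a b' c aA b'B cC).
have [nba nbc _] := orient_gt0_neq _ _ _ (ABC_gt0 a' b c' a'A bB c'C).
have [_ ncb nca] := orient_gt0_neq _ _ _ (ABC_gt0 a' b' c a'A b'B cC).
have : a \in [set a'; b'; c'] by rewrite -e !inE eqxx.
have : b \in [set a'; b'; c'] by rewrite -e !inE eqxx orbT.
have : c \in [set a'; b'; c'] by rewrite -e !inE eqxx orbT.
rewrite !inE (negbTE nac) (negbTE nab) (negbTE nbc) !(eq_sym _ a') !(eq_sym c b').
by rewrite (negbTE nba) (negbTE ncb) (negbTE nca) !orbF /= => /eqP-> /eqP-> /eqP->.
Qed.

Lemma avoids_transversals : avoids p [set Ears; Bat; Mariposa] transversals.
Proof.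
apply/andP; split; first by apply/forall_inP => t /card_transversal ->.
apply/forall_inP=> t1 t1F; apply/forall_inP=> t2 t2F; apply/implyP=> _.
apply/forall_inP => c cX; apply/negP => cf.
have [] : separated t1 t2 \/ separated t2 t1; last 2 first.
- exact: transversals_not_separated.
- exact: transversals_not_separated.
move: cX; rewrite !inE => /orP[/orP[]|] /eqP ec; rewrite {}ec in cf.
- exact: ears_separated.
- exact: bat_separated.
- by left; apply: mariposa_separated.
Qed.

End Transversals.
End Separation.

Theorem theorem2 (R : realType) :
  exists2 c : R, 0 < c & exists N : nat, forall n : nat, (N <= n)%N ->
    forall p : 'I_n -> 'rV[R]_2, convex_position p ->
      c * n%:R ^+ 3 <= (ex_triangles p [set Ears; Bat; Mariposa])%:R.
Proof.
(* One point is set aside by [three_arcs], so the arcs have [m = n.-1 %/ 3] points, and [n <= 6 * m]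
   once [n >= 6]. The family of size [m ^ 3] then has at least (n/6)^3 triangles. *)
exists (6 ^- 3); first by rewrite invr_gt0 exprn_gt0.
exists 6%N => n n6 p p_convex; pose m := (n.-1 %/ 3)%N.
have [|A [B [C [cA cB cC ABC]]]] := @three_arcs _ _ _ p_convex m; first lia.
have h : (m ^ 3 <= ex_triangles p [set Ears; Bat; Mariposa])%N.
  have -> : (m ^ 3 = #|transversals n A B C|)%N.
    by rewrite (card_transversals _ _ _ _ _ _ ABC) cA cB cC !expnS expn0 muln1 mulnA.
  exact: leq_bigmax_cond (avoids_transversals _ _ _ _ _ _ ABC).
rewrite mulrC ler_pdivrMr ?exprn_gt0 // -!natrX -natrM ler_nat.
apply: leq_trans (leq_mul h (leqnn _)); rewrite -expnMn leq_exp2r //; lia.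
Qed.
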